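(* Let $\Omega$ be a nonempty open subset of $\mathbb{C}$. Then the set $\mathcal{S}_{p} \setminus \mathcal{S}_{uc}$ is pointwise spaceable in $H(\Omega)^{\mathbb{N}}$; that is, for every $\mathbf{f} \in \mathcal{S}_p \setminus \mathcal{S}_{uc}$ there exists a closed infinite dimensional vector subspace $M_{\mathbf{f}}$ of $H(\Omega)^{\mathbb{N}}$ such that $\mathbf{f} \in M_{\mathbf{f}} \subset (\mathcal{S}_p \setminus \mathcal{S}_{uc}) \cup \{0\}$.
   Context: $\mathbb{N}=\{1,2,3,\dots\}$. $H(\Omega)$ is the complex vector space of all holomorphic functions on $\Omega$ (not assumed connected), endowed with the topology of uniform convergence on compact subsets of $\Omega$. $H(\Omega)^{\mathbb{N}}$ is the vector space of all sequences $(f_n)_{n\in\mathbb{N}}$ in $H(\Omega)$ with coordinatewise operations, endowed with the product topology. Define $\mathcal{S}_p = \{(f_n)\in H(\Omega)^{\mathbb{N}} : f_n \to 0 \text{ pointwise on } \Omega\}$ and $\mathcal{S}_{uc} = \{(f_n)\in H(\Omega)^{\mathbb{N}} : f_n \to 0 \text{ uniformly on each compact subset of } \Omega\}$. A subset $A$ of a topological vector space $X$ is called pointwise spaceable if for every $x\in A$ there exists a closed infinite dimensional vector subspace $M_x\subset X$ such that $x\in M_x\subset A\cup\{0\}$. *)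

(* Defs.v *)
From HB Require Import structures.
From mathcomp Require Import all_boot all_order all_algebra.
From mathcomp Require Import complex.
From mathcomp Require Import all_classical all_reals all_analysis.

Set Implicit Arguments.
Unset Strict Implicit.
Unset Printing Implicit Defensive.

Import Order.TTheory GRing.Theory Num.Theory.
Import numFieldNormedType.Exports.

Local Open Scope classical_set_scope.
Local Open Scope ring_scope.
Local Open Scope complex_scope.

Section HolomorphicFunctions.
(* The regular algebra R[i]^o is the alias of R[i] that carries the topology
   and the normed-module structure over the scalar field R[i]. *)
Context {R : realType}.
Local Notation C := (R[i]^o).
Implicit Types (Omega : set C) (f : C -> C).

(* [derivable f z 1] is complex differentiability: the increment ranges over
   the scalar field R[i]. *)
Definition holomorphic_on Omega f := forall z, Omega z -> derivable f z 1.

(* A function on Omega is represented by its extension by 0, so that equality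
   in [holo Omega] is equality on Omega. *)
Definition holo_pred Omega : {pred C -> C} :=
  [pred f | `[< holomorphic_on Omega f /\ forall z, ~ Omega z -> f z = 0 >]].

Lemma holo_submod_closed Omega : submod_closed (holo_pred Omega).
Proof.
split.
  apply/asboolP; split; last by [].
  move=> z _; exact: derivable_cst.
move=> a f g /asboolP[df f0] /asboolP[dg g0]; apply/asboolP; split.
  by move=> z Oz; apply: derivableD (dg z Oz); apply: derivableZ; exact: df.
move=> z Oz.
have -> : (a *: f + g) z = a *: f z + g z by [].
by rewrite f0// g0// addr0 scaler0.
Qed.

HB.instance Definition _ Omega :=
  GRing.isSubmodClosed.Build R[i] (C -> C) (holo_pred Omega)
    (holo_submod_closed Omega).

Definition holo Omega := {f : C -> C | f \in holo_pred Omega}.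

HB.instance Definition _ Omega := SubChoice.on (holo Omega).
HB.instance Definition _ Omega :=
  [SubChoice_isSubLmodule of holo Omega by <:].

Definition compact_in Omega : set (set C) :=
  [set K | compact K /\ K `<=` Omega].

HB.instance Definition _ Omega := Uniform.copy (holo Omega)
  (initial_topology
     (\val : holo Omega -> {family compact_in Omega, C -> C})).

Lemma holo_cvgP Omega (F : set_system (holo Omega)) (f : holo Omega) :
  Filter F ->
  F --> f <-> forall K, compact_in Omega K -> forall e : C, 0 < e ->
    \forall g \near F, forall z, K z -> `|val f z - val g z| < e.
Proof.
move=> FF; split=> [Ff K OK e e0|Ff U].
- have valf : {family compact_in Omega, (\val @ F) --> (\val f)}.
    move=> U /(@initial_continuous _ {family compact_in Omega, C -> C} \val f).
    exact: Ff.
  have /fam_cvgP/(_ K OK) := valf.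
  move=> /(_ [set g | forall z, K z -> `|val f z - g z| < e]); apply.
  apply/uniform_nbhs; exists [set xy | `|xy.1 - xy.2| < e]; split=> //.
  rewrite -entourage_ballE; exists e => //= -[x y].
- case=> ? [[W oW <-] /= Wf] /filterS; apply.
  have : {family compact_in Omega, (\val @ F) --> (\val f)}.
    apply/fam_cvgP => K OK P /uniform_nbhs[E [entE EP]].
    move: entE; rewrite -entourage_ballE => -[e /= e0 eE].
    have := Ff K OK e e0; apply: filterS => g fg.
    by apply: EP => z Kz; apply: eE; exact: fg.
  by apply; exact: open_nbhs_nbhs.
Qed.

Lemma holo_add_continuous Omega :
  continuous (fun fg : holo Omega * holo Omega => fg.1 + fg.2).
Proof.
move=> [f g]; apply/holo_cvgP => K OK e e0.
have e20 : 0 < e / 2 by rewrite divr_gt0.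
have nf := (holo_cvgP f _).1 (cvg_fst (F := nbhs f) (G := nbhs g)) K OK _ e20.
have ng := (holo_cvgP g _).1 (cvg_snd (F := nbhs f) (G := nbhs g)) K OK _ e20.
near_simpl; near=> h => z Kz.
have -> : val (f + g) z - val (h.1 + h.2) z =
  (val f z - val h.1 z) + (val g z - val h.2 z).
  have -> : val (f + g) z = val f z + val g z by [].
  have -> : val (h.1 + h.2) z = val h.1 z + val h.2 z by [].
  by rewrite opprD addrACA.
rewrite (le_lt_trans (ler_normD _ _))// (splitr e) ltrD//.
  by move: z Kz; near: h; exact: nf.
by move: z Kz; near: h; exact: ng.
Unshelve. all: by end_near. Qed.

Lemma holo_bounded Omega (f : holo Omega) K : compact_in Omega K ->
  exists2 M : C, 0 < M & forall z, K z -> `|val f z| <= M.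
Proof.
move=> [/compact_near_coveringP Kc KO].
have /asboolP[df _] : val f \in holo_pred Omega by exact: valP.
suff [N _ NP] : \forall n \near \oo, K `<=` (fun z => `|val f z| <= n%:R).
  exists N.+1%:R; first by rewrite ltr0n.
  exact: (NP N.+1 (leqnSn N)).
apply: Kc => z Kz.
have /derivable1_diffP/differentiable_continuous fz := df z (KO z Kz).
have /cvgrPdist_lt/(_ 1 ltr01) fz1 := fz.
exists ([set w | `|val f z - val f w| < 1],
        [set n | `|val f z| + 1 <= n%:R :> C]) => /=.
  split=> //.
  pose r := Num.sqrt (complex.Re (val f z) ^+ 2 + complex.Im (val f z) ^+ 2).
  exists (Num.bound r).+1 => // n /= rn.
  apply: (@le_trans _ _ (Num.bound r).+1%:R); last by rewrite ler_nat.
  rewrite -natr1 lerD2r [`|_|](normc_def (val f z)) -/r.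
  rewrite -(rmorph_nat (real_complex R)) lecR ltW//.
  by apply: archi_boundP; exact: sqrtr_ge0.
move=> -[w n] /= [fw zn]; apply: le_trans zn.
by rewrite -[val f w](subKr (val f z)) (le_trans (ler_normB _ _))// lerD2l ltW.
Qed.

Lemma holo_scale_continuous Omega :
  continuous (fun af : C * holo Omega => af.1 *: af.2).
Proof.
move=> [a f]; apply/holo_cvgP => K OK e e0.
have [M M0 fM] := holo_bounded f OK.
have d0 : 0 < e / 2 / (`|a| + 1) by rewrite !divr_gt0// ltr_wpDl.
have d'0 : 0 < e / 2 / M by rewrite !divr_gt0.
have nf := (holo_cvgP f _).1 (cvg_snd (F := nbhs a) (G := nbhs f)) K OK _ d0.
have na0 : x.1 @[x --> filter_prod (nbhs (a : C)) (nbhs f)] --> (a : C).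
  exact: cvg_fst.
have na (d : C) : 0 < d -> \forall x \near (a : C, f), `|a - x.1| < d.
  by move=> dgt0; exact: (cvgrPdist_lt _ _).1 na0 d dgt0.
have na1 := na _ ltr01; have {}na := na _ d'0.
near_simpl; near=> h => z Kz.
have -> : val (a *: f) z - val (h.1 *: h.2) z =
    (a - h.1) * val f z + h.1 * (val f z - val h.2 z).
  have -> : val (a *: f) z = a * val f z by [].
  have -> : val (h.1 *: h.2) z = h.1 * val h.2 z by [].
  by rewrite mulrBl mulrBr addrA subrK.
rewrite (le_lt_trans (ler_normD _ _))// (splitr e) ler_ltD// normrM.
  rewrite -[leRHS](divfK (lt0r_neq0 M0)) ler_pM//; last exact: fM.
  by apply: ltW; near: h; exact: na.
rewrite -[ltRHS](@divfK _ (`|a| + 1)); last by rewrite lt0r_neq0// ltr_wpDl.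
rewrite mulrC; apply: (@le_lt_trans _ _ (`|val f z - val h.2 z| * (`|a| + 1))).
  rewrite ler_wpM2l// -[h.1](subKr a) (le_trans (ler_normB _ _))// lerD2l.
  by apply: ltW; near: h; exact: na1.
rewrite ltr_pM2r; last by rewrite ltr_wpDl.
by move: z Kz; near: h; exact: nf.
Unshelve. all: by end_near. Qed.

HB.instance Definition _ Omega :=
  PreTopologicalNmodule_isTopologicalNmodule.Build (holo Omega)
    (@holo_add_continuous Omega).
HB.instance Definition _ Omega :=
  TopologicalNmodule_isTopologicalLmodule.Build R[i] (holo Omega)
    (@holo_scale_continuous Omega).

(* The space of sequences, with the product topology; index n stands for the
   (n+1)-st term of the sequence. *)
Definition holo_seq Omega : Type := {ptws nat -> holo Omega}.

HB.instance Definition _ Omega := Uniform.on (holo_seq Omega).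
HB.instance Definition _ Omega :=
  GRing.Lmodule.copy (holo_seq Omega) (nat -> holo Omega).

Lemma holo_seq_cvgP Omega (F : set_system (holo_seq Omega))
    (f : holo_seq Omega) : Filter F ->
  F --> f <-> forall n, g n @[g --> F] --> f n.
Proof.
move=> FF; split=> [Ff n|Ff].
- move=> U /(@proj_continuous nat (fun=> holo Omega) n f).
  exact: Ff.
- apply/cvg_sup => n U [? [[W oW <-] /= Wf]] /filterS; apply.
  by apply: (Ff n); exact: open_nbhs_nbhs.
Qed.

Lemma holo_seq_add_continuous Omega :
  continuous (fun fg : holo_seq Omega * holo_seq Omega => fg.1 + fg.2).
Proof.
move=> [f g]; apply/holo_seq_cvgP => n.
pose pr (h : holo_seq Omega) := h n.
have prc : continuous pr by exact: (@proj_continuous nat (fun=> holo Omega) n).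
apply: (@continuous_comp _ _ _
  (fun fg : holo_seq Omega * holo_seq Omega => (pr fg.1, pr fg.2))
  (fun h : holo Omega * holo Omega => h.1 + h.2)).
  apply: (@cvg_pair _ _ _ _ (nbhs (pr f)) (nbhs (pr g))).
    by move=> U /prc; apply: (cvg_fst (F := nbhs f) (G := nbhs g)).
  by move=> U /prc; apply: (cvg_snd (F := nbhs f) (G := nbhs g)).
exact: add_continuous.
Qed.

Lemma holo_seq_scale_continuous Omega :
  continuous (fun af : C * holo_seq Omega => af.1 *: af.2).
Proof.
move=> [a f]; apply/holo_seq_cvgP => n.
pose pr (h : holo_seq Omega) := h n.
have prc : continuous pr by exact: (@proj_continuous nat (fun=> holo Omega) n).
apply: (@continuous_comp _ _ _
  (fun af : C * holo_seq Omega => (af.1, pr af.2))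
  (fun h : C * holo Omega => h.1 *: h.2)).
  apply: (@cvg_pair _ _ _ _ (nbhs (a : C)) (nbhs (pr f))).
    exact: cvg_fst.
  by move=> U /prc; apply: (cvg_snd (F := nbhs (a : C)) (G := nbhs f)).
exact: scale_continuous.
Qed.

HB.instance Definition _ Omega :=
  PreTopologicalNmodule_isTopologicalNmodule.Build (holo_seq Omega)
    (@holo_seq_add_continuous Omega).
HB.instance Definition _ Omega :=
  TopologicalNmodule_isTopologicalLmodule.Build R[i] (holo_seq Omega)
    (@holo_seq_scale_continuous Omega).

Definition S_p Omega : set (holo_seq Omega) :=
  [set f | forall z, Omega z -> val (f n) z @[n --> \oo] --> (0 : C)].

Definition S_uc Omega : set (holo_seq Omega) :=
  [set f | forall K, compact K -> K `<=` Omega ->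
    {uniform K, (fun n => val (f n)) @ \oo --> (fun=> 0 : C)}].

End HolomorphicFunctions.

Arguments S_p {R} Omega _.
Arguments S_uc {R} Omega _.

Section PointwiseSpaceable.
Context {K : numFieldType} {X : topologicalLmodType K}.
Implicit Types M A : set X.

Definition is_subspace M :=
  M 0 /\ forall (a : K) u v, M u -> M v -> M (a *: u + v).

Definition finite_dimensional M := exists (n : nat) (v : 'I_n -> X),
  (forall i, M (v i)) /\
  (forall x, M x -> exists c : 'I_n -> K, x = \sum_(i < n) c i *: v i).

Definition pointwise_spaceable A := forall x, A x ->
  exists M : set X,
    [/\ is_subspace M, closed M, ~ finite_dimensional M, M x
      & M `<=` A `|` [set 0]].

End PointwiseSpaceable.

(* Main.v *)
(* Multiplying [f] by scalar sequences does not suffice: a closed subspace of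
   [C^nat] consisting of bounded sequences is finite dimensional.  Instead, one
   coordinate of the sequence carries a function [psi] from a closed infinite
   dimensional subspace [W] of [H(Omega)], and [f n] is multiplied by
   [c + psi (w (kappa n))], where the points [w k] lie in a compact subset of
   [Omega], so that the multipliers are bounded, and each of them occurs for
   infinitely many of the indices [n] at which [f n] is large on the compact set
   on which [f] does not tend to 0 uniformly.  A sequence of this form in
   [S_uc] has [c + psi (w k) = 0] for all [k].

   It remains to find [W] on which the values [psi (w k)] determine [psi],
   even though [Omega] need not be connected.  Take the closure of the span of
   the lacunary powers [(z - z0)^(2^k)].  If [omega] is a root of unity of order
   [2^(k+1)], then [p(v) - p(v omega)] has no terms of index [> k] and twice the
   k-th term of [p(v)]; hence the k-th term is at most [2^k] times the size of
   [p] on an arc, however short, around [v], up to finitely many low-order terms,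
   which are controlled on a circle around [z0].  Applying this at
   [v = (1 + 2^-s) u] bounds the tail of [p] at [u]. *)
Require Import Defs.
From mathcomp Require Import all_boot all_order all_algebra.
From mathcomp Require Import complex.
From mathcomp Require Import all_classical all_reals all_analysis.
From mathcomp Require Import zify ring.

Set Implicit Arguments.
Unset Strict Implicit.
Unset Printing Implicit Defensive.

Import Order.TTheory GRing.Theory Num.Theory.
Import numFieldNormedType.Exports.

Local Open Scope classical_set_scope.
Local Open Scope ring_scope.
Local Open Scope complex_scope.

(** * Coefficient and tail estimates for lacunary polynomials *)

Section LacunaryPolynomials.
Context {C : numFieldType}.
Implicit Types (p q : {poly C}) (u v : C).

(** [p] serves as a finite coefficient sequence, not as the polynomial it denotes. *)
Definition lacunary p u := \sum_(i < size p) p`_i * u ^+ (2 ^ i).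

Lemma lacunaryE n p u : (size p <= n)%N ->
  lacunary p u = \sum_(i < n) p`_i * u ^+ (2 ^ i).
Proof.
move=> pn; rewrite /lacunary (big_ord_widen n (fun i => p`_i * u ^+ (2 ^ i)))//.
rewrite big_mkcond /=; apply: eq_bigr => i _; case: ltnP => // pi.
by rewrite nth_default// mul0r.
Qed.

Lemma lacunary_linear a p q u :
  lacunary (a *: p + q) u = a * lacunary p u + lacunary q u.
Proof.
pose n := maxn (size (a *: p + q)) (maxn (size p) (size q)).
rewrite !(@lacunaryE n) ?leq_max ?leqnn ?orbT//.
rewrite mulr_sumr -big_split /=; apply: eq_bigr => i _.
by rewrite coefD coefZ mulrDl mulrA.
Qed.

Lemma lacunaryXn k u : lacunary 'X^k u = u ^+ (2 ^ k).
Proof.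
rewrite /lacunary size_polyXn big_ord_recr /= coefXn eqxx mul1r big1 ?add0r//.
by move=> i _; rewrite coefXn (ltn_eqF (ltn_ord i)) mul0r.
Qed.

Lemma lacunary0 u : lacunary 0 u = 0.
Proof. by rewrite /lacunary size_poly0 big_ord0. Qed.

Lemma lacunary_at0 p : lacunary p 0 = 0.
Proof.
by rewrite /lacunary big1// => i _; rewrite expr0n expn_eq0/= mulr0.
Qed.

(** In the application [omega k] is a primitive root of unity of order [2^k]. *)
Variable omega : nat -> C.
Hypothesis omega_norm : forall k, `|omega k| = 1.
Hypothesis omega_le : forall i k, (k <= i)%N -> omega k ^+ (2 ^ i) = 1.
Hypothesis omegaS : forall k, omega k.+1 ^+ (2 ^ k) = -1.

(* In [p(v) - p(v omega_(k+1))] the terms of index [> k] cancel and the k-th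
   one doubles. *)
Lemma lacunary_term_le p v P k :
  `|lacunary p v| <= P -> `|lacunary p (v * omega k.+1)| <= P ->
  `|p`_k * v ^+ (2 ^ k)| <= P + \sum_(i < k) `|p`_i * v ^+ (2 ^ i)|.
Proof.
move=> pv pw; pose n := (size p + k.+1)%N.
have kn : (k < n)%N by rewrite /n; lia.
pose t i := p`_i * v ^+ (2 ^ i) * (1 - omega k.+1 ^+ (2 ^ i)).
have diffE : lacunary p v - lacunary p (v * omega k.+1) =
    \sum_(i < k) t i + 2 * (p`_k * v ^+ (2 ^ k)).
  rewrite !(@lacunaryE n) ?leq_addr// -sumrB.
  have -> : \sum_(i < n) (p`_i * v ^+ (2 ^ i) -
      p`_i * (v * omega k.+1) ^+ (2 ^ i)) = \sum_(i < n) t i.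
    by apply: eq_bigr => i _; rewrite /t exprMn; ring.
  rewrite -!(big_mkord xpredT t) (big_cat_nat (n := k.+1))//= big_nat_recr//=.
  have -> : t k = 2 * (p`_k * v ^+ (2 ^ k)) by rewrite /t omegaS; ring.
  suff -> : \sum_(k.+1 <= i < n) t i = 0 by rewrite addr0.
  rewrite big_nat_cond big1// => i /andP[/andP[ki _] _].
  by rewrite /t omega_le// subrr mulr0.
have t_le i : `|t i| <= 2 * `|p`_i * v ^+ (2 ^ i)|.
  rewrite normrM mulrC ler_wpM2r// (le_trans (ler_normB _ _))//.
  by rewrite normrX omega_norm expr1n normr1.
rewrite -(@ler_pM2l _ 2)// -[in leLHS](@normr_nat C 2) -normrM.
have -> : 2 * (p`_k * v ^+ (2 ^ k)) =
    (lacunary p v - lacunary p (v * omega k.+1)) - \sum_(i < k) t i.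
  by rewrite diffE; ring.
rewrite (le_trans (ler_normB _ _))// mulrDr lerD//.
  by rewrite (le_trans (ler_normB _ _))// mulr_natl mulr2n lerD.
by rewrite mulr_sumr (le_trans (ler_norm_sum _ _ _))// ler_sum.
Qed.

(** By [lacunary_term_le] the bound [T j] at most doubles at each step from [k0] on. Starting at
    [k0] uses only roots of unity close to 1, so a short arc suffices. *)
Lemma lacunary_coef_le p v P k0 k : (k0 <= k)%N ->
  `|lacunary p v| <= P ->
  (forall j, (k0 <= j)%N -> `|lacunary p (v * omega j.+1)| <= P) ->
  `|p`_k * v ^+ (2 ^ k)| <=
    2 ^+ k * (P + \sum_(i < k0) `|p`_i * v ^+ (2 ^ i)|).
Proof.
move=> k0k pv pw; pose T j := P + \sum_(i < j) `|p`_i * v ^+ (2 ^ i)|.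
have T0 j : 0 <= T j.
  by rewrite addr_ge0 ?sumr_ge0// (le_trans _ pv).
have TS j : (k0 <= j)%N -> T j.+1 <= 2 * T j.
  move=> k0j; rewrite mulr_natl mulr2n {1}/T big_ord_recr /= addrA lerD//.
  by apply: lacunary_term_le => //; exact: pw.
have Tk l : T (k0 + l)%N <= 2 ^+ l * T k0.
  elim: l => [|l IH]; first by rewrite addn0 expr0 mul1r.
  rewrite addnS (le_trans (TS _ _)) ?leq_addr//.
  by rewrite exprS -mulrA ler_pM2l.
have -> : k = (k0 + (k - k0))%N by rewrite subnKC.
rewrite (le_trans (lacunary_term_le pv (pw _ _))) ?leq_addr//.
rewrite (le_trans (Tk _))// ler_wpM2r//.
by rewrite ler_weXn2l ?ler1n// leq_addl.
Qed.

(** Bernoulli's inequality. *)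
Lemma one_plus_expn_ge (h : C) n : 0 <= h -> 1 + h *+ n <= (1 + h) ^+ n.
Proof.
move=> h0; elim: n => [|n IH]; first by rewrite mulr0n addr0 expr0.
rewrite exprS (@le_trans _ _ ((1 + h) * (1 + h *+ n)))//; last first.
  by rewrite ler_wpM2l// addr_ge0.
have -> : (1 + h) * (1 + h *+ n) = 1 + h *+ n.+1 + h * (h *+ n).
  by rewrite mulrS; ring.
by rewrite lerDl mulr_ge0// mulrn_wge0.
Qed.

(** Bernoulli gives [(1 + 2^-s)^(2^s) >= 2], and [2^(2^l) >= 4^l]. This growth outweighs the loss
    [2^k] in [lacunary_coef_le]. *)
Lemma dilation_expn_ge s l :
  4 ^+ l <= (1 + (2 ^+ s)^-1) ^+ (2 ^ (s + l)) :> C.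
Proof.
have s0 : (2 ^+ s : C) != 0 by rewrite expf_neq0// pnatr_eq0.
have dil : 2 <= (1 + (2 ^+ s)^-1) ^+ (2 ^ s) :> C.
  apply: le_trans (one_plus_expn_ge _ _); last by rewrite invr_ge0 exprn_ge0.
  by rewrite -[X in 1 + X]mulr_natr natrX mulVf.
rewrite expnD exprM (@le_trans _ _ (2 ^+ (2 ^ l)))//.
  have -> : (4 : C) = 2 ^+ 2 by rewrite expr2; ring.
  rewrite -exprM ler_weXn2l ?ler1n//.
  by elim: l => // l; rewrite expnS; case: l => //; lia.
by rewrite lerXn2r ?nnegrE// (le_trans _ dil).
Qed.

(* The coefficient estimate at [v = (1 + 2^-s) u] makes the tail at [u] small
   uniformly in [p], although [p] is only controlled near [v]. *)
Lemma lacunary_le p u s k0 L P : (k0 <= s + L)%N ->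
  let v := (1 + (2 ^+ s)^-1) * u in
  `|lacunary p v| <= P ->
  (forall j, (k0 <= j)%N -> `|lacunary p (v * omega j.+1)| <= P) ->
  `|lacunary p u| <= \sum_(i < s + L) `|p`_i * u ^+ (2 ^ i)| +
    2 ^+ s.+1 / 2 ^+ L * (P + \sum_(i < k0) `|p`_i * v ^+ (2 ^ i)|).
Proof.
move=> k0L v pv pw.
set Q := P + _.
have Q0 : 0 <= Q by rewrite addr_ge0 ?sumr_ge0// (le_trans _ pv).
(* Passing from [v] to [u] gains [4^(L+l)] against the loss [2^(s+L+l)], which leaves a geometric
   series in [l]. *)
have term l : `|p`_(s + (L + l)) * u ^+ (2 ^ (s + (L + l)))| <=
    2 ^+ s / 2 ^+ L * Q / 2 ^+ l.
  have := lacunary_coef_le (leq_trans k0L (leq_addr l _)) pv pw.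
  rewrite -/Q -addnA => H.
  have D0 : 0 < (1 + (2 ^+ s)^-1) ^+ (2 ^ (s + (L + l))) :> C.
    by rewrite exprn_gt0// addr_gt0// invr_gt0 exprn_gt0.
  have : `|p`_(s + (L + l)) * u ^+ (2 ^ (s + (L + l)))| * 4 ^+ (L + l) <=
      2 ^+ (s + (L + l)) * Q.
    apply: le_trans H; set m := (2 ^ _)%N.
    have -> : p`_(s + (L + l)) * v ^+ m =
        (1 + (2 ^+ s)^-1) ^+ m * (p`_(s + (L + l)) * u ^+ m).
      by rewrite /v exprMn; ring.
    rewrite [leRHS]normrM [leLHS]mulrC.
    rewrite ler_wpM2r// (ger0_norm (ltW D0)); exact: dilation_expn_ge.
  rewrite -ler_pdivlMr ?exprn_gt0// => /le_trans; apply.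
  have -> : (4 : C) = 2 * 2 by ring.
  rewrite exprMn !exprD le_eqVlt; apply/orP; left; apply/eqP; field.
  by rewrite ?expf_neq0// pnatr_eq0.
have geo n : \sum_(l < n) 2 ^+ s / 2 ^+ L * Q / 2 ^+ l <=
    2 ^+ s.+1 / 2 ^+ L * Q.
  rewrite (@le_trans _ _ (2 ^+ s / 2 ^+ L * Q * (2 - (2 ^+ n)^-1 * 2)))//.
    rewrite le_eqVlt; apply/orP; left; apply/eqP.
    elim: n => [|n IH]; first by rewrite big_ord0 expr0 invr1; ring.
    rewrite big_ord_recr /= IH exprS; field.
    by rewrite ?expf_neq0// pnatr_eq0.
  have -> : 2 ^+ s.+1 / 2 ^+ L * Q = 2 ^+ s / 2 ^+ L * Q * 2.
    by rewrite exprS; ring.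
  rewrite ler_wpM2l ?mulr_ge0 ?invr_ge0 ?exprn_ge0// gerBl.
  by rewrite mulr_ge0// invr_ge0 exprn_ge0.
rewrite (@lacunaryE (s + L + size p)) ?leq_addl//.
rewrite (le_trans (ler_norm_sum _ _ _))// big_split_ord /= lerD2l.
apply: le_trans (geo (size p)); apply: ler_sum => i _.
by have := term i; rewrite addnA.
Qed.

End LacunaryPolynomials.

(** * Circular arcs and roots of unity of order [2^k] *)

Section Arcs.
Context {R : realType}.
Local Notation C := (R[i]^o).
Implicit Types (Omega : set C) (z u v : C) (x t : R).

Definition cis x : C := cos x +i* sin x.

Lemma cisD x t : cis (x + t) = cis x * cis t.
Proof.
rewrite /cis cosD sinD; apply/eqP; rewrite eq_complex /= eqxx /=.
by apply/eqP; rewrite addrC [sin x * _]mulrC.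
Qed.

Lemma cis0 : cis 0 = 1.
Proof. by rewrite /cis cos0 sin0. Qed.

Lemma cisX x n : cis x ^+ n = cis (x *+ n).
Proof.
elim: n => [|n IH]; first by rewrite mulr0n cis0 expr0.
by rewrite exprS IH mulrS cisD.
Qed.

Lemma norm_cis x : `|cis x| = 1.
Proof. by rewrite [LHS]normc_def /= cos2Dsin2 sqrtr1. Qed.

Lemma cis_continuous : continuous (cis : R -> C).
Proof.
(* A positive element of [R[i]] is real, so [e] can be split in [R] between cosine and sine. *)
move=> x; apply/cvgrPdist_lt => -[e e'] /=; rewrite ltcE /= => /andP[/eqP-> e0].
have e20 : 0 < e / 2 by rewrite divr_gt0.
have /cvgrPdist_lt/(_ _ e20) cx := @continuous_cos R x.
have /cvgrPdist_lt/(_ _ e20) sx := @continuous_sin R x.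
near=> t.
have -> : cis x - cis t = (cos x - cos t)%:C + 'i * (sin x - sin t)%:C.
  rewrite /cis; apply/eqP; rewrite eq_complex /=.
  by rewrite !(mul0r, mul1r, subr0, add0r, addr0, mulr0) !eqxx.
rewrite (le_lt_trans (ler_normD _ _))// normrM.
have n1 : `|'i : R[i]| = 1.
  by rewrite normc_def /= expr0n expr1n add0r sqrtr1.
have nr (y : R) : `|y%:C| = `|y|%:C.
  by rewrite normc_def /= expr0n addr0 sqrtr_sqr.
rewrite n1 mul1r !nr -rmorphD /= complexr0 ltcR (splitr e) ltrD//.
  by near: t.
by near: t.
Unshelve. all: by end_near. Qed.

Lemma pi2_ge0 : 0 <= pi *+ 2 :> R.
Proof. by apply: mulrn_wge0; exact: pi_ge0. Qed.

Definition root2 k : C := cis (pi *+ 2 / 2 ^+ k).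

Lemma norm_root2 k : `|root2 k| = 1.
Proof. exact: norm_cis. Qed.

Lemma root2_expn k : root2 k ^+ (2 ^ k) = 1.
Proof.
rewrite cisX -[_ *+ (2 ^ _)]mulr_natr natrX divfK ?expf_neq0 ?pnatr_eq0//.
by rewrite /cis cos2pi sin2pi.
Qed.

Lemma root2_le i k : (k <= i)%N -> root2 k ^+ (2 ^ i) = 1.
Proof.
by move=> ki; rewrite -(subnKC ki) expnD exprM root2_expn expr1n.
Qed.

Lemma root2S k : root2 k.+1 ^+ (2 ^ k) = -1.
Proof.
rewrite cisX -[_ *+ (2 ^ _)]mulr_natr natrX.
have -> : pi *+ 2 / 2 ^+ k.+1 * 2 ^+ k = pi :> R.
  by rewrite exprS; field; rewrite expf_neq0 ?pnatr_eq0.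
by rewrite /cis cospi sinpi; apply/eqP; rewrite eq_complex /= oppr0 !eqxx.
Qed.

(** The full circle for [k = 0]; in general just long enough to contain [z + v * root2 j] for all
    [j >= k]. *)
Definition cis_arc z v k : set C :=
  [set z + v * cis x | x in `[0, pi *+ 2 / 2 ^+ k]%classic].

Lemma cis_arc_compact z v k : compact (cis_arc z v k).
Proof.
apply: continuous_compact; last exact: segment_compact.
apply: continuous_subspaceT => x.
apply: cvgD; first exact: cvg_cst.
apply: cvgM; first exact: cvg_cst.
exact: cis_continuous.
Qed.

Lemma cis_arc_start z v k : cis_arc z v k (z + v).
Proof.
exists 0; last by rewrite cis0 mulr1.
by rewrite /= in_itv /= lexx divr_ge0// ?exprn_ge0// pi2_ge0.
Qed.

Lemma cis_arc_root2 z v k j : (k <= j)%N -> cis_arc z v k (z + v * root2 j).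
Proof.
move=> kj; exists (pi *+ 2 / 2 ^+ j) => //.
rewrite /= in_itv /= divr_ge0 ?exprn_ge0// ?pi2_ge0//=.
rewrite ler_wpM2l ?pi2_ge0// lef_pV2 ?posrE ?exprn_gt0//.
by rewrite ler_weXn2l// ler1n.
Qed.

Lemma open_circle Omega z : open Omega -> Omega z ->
  exists2 r : C, 0 < r & forall k, cis_arc z r k `<=` Omega.
Proof.
move=> oO Oz.
have /nbhs_ballP[e /= e0 eO] : nbhs z Omega by exact: open_nbhs_nbhs.
exists (e / 2); first by rewrite divr_gt0.
move=> k _ [x _ <-]; apply: eO; rewrite -ball_normE /= opprD addrA subrr add0r.
rewrite normrN normrM norm_cis mulr1 ger0_norm ?divr_ge0 ?ltW//.
by rewrite ltr_pdivrMr// ltr_pMr// ltr1n.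
Qed.

Lemma complex_archi z : exists n, `|z| <= n%:R.
Proof.
(* The norm takes values in [R[i]]; the Archimedean property is applied to its real part. *)
exists (Num.bound (complex.Re `|z|)).
rewrite -(rmorph_nat (real_complex R)) -[`|z|]RRe_real ?normr_real//.
by rewrite lecR ltW// archi_boundP// -ler0c RRe_real ?normr_real.
Qed.

Lemma complex_dyadic_lt z (e : C) : 0 < e -> exists n, `|z| / 2 ^+ n < e.
Proof.
move=> e0; have [n zn] := complex_archi (z / e).
exists n; rewrite ltr_pdivrMr ?exprn_gt0// mulrC -ltr_pdivrMr//.
rewrite -[X in _ / X](gtr0_norm e0) -normf_div (le_lt_trans zn)//.
by rewrite -natrX ltr_nat ltn_expl.
Qed.

(** First [s] brings the dilated point within half the radius of a ball around [z + u]; then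
    continuity of [cis] at 0 yields an arc short enough for the other half. *)
Lemma open_dilated_arc Omega z u : open Omega -> Omega (z + u) ->
  exists s k, cis_arc z ((1 + (2 ^+ s)^-1) * u) k `<=` Omega.
Proof.
move=> oO Oz.
have /nbhs_ballP[e /= e0 eO] : nbhs (z + u) Omega by exact: open_nbhs_nbhs.
have e20 : 0 < e / 2 by rewrite divr_gt0.
have [s us] := complex_dyadic_lt u e20.
pose v := (1 + (2 ^+ s)^-1) * u.
have vc : (v * cis x : C) @[x --> (0 : R)] --> (v * cis 0 : C).
  by apply: cvgM; [exact: cvg_cst|exact: cis_continuous].
have /cvgrPdist_lt/(_ _ e20)/nbhs_ballP[d /= d0 dP] := vc.
have [k kd] : exists k, pi *+ 2 / 2 ^+ k < d :> R.
  exists (Num.bound (pi *+ 2 / d)).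
  rewrite ltr_pdivrMr ?exprn_gt0// mulrC -ltr_pdivrMr//.
  apply: (@lt_trans _ _ (Num.bound (pi *+ 2 / d))%:R).
    by rewrite archi_boundP// divr_ge0 ?pi2_ge0// ltW.
  by rewrite -natrX ltr_nat ltn_expl.
exists s, k => y [x /=]; rewrite in_itv /= => /andP[x0 xk] <-{y}.
apply: eO; rewrite -ball_normE /= -/v.
have -> : z + u - (z + v * cis x) = (v * cis 0 - v * cis x) - u / 2 ^+ s.
  by rewrite cis0 /v; ring.
rewrite (le_lt_trans (ler_normB _ _))// (splitr e) ltrD//.
  apply: dP; rewrite -ball_normE /= sub0r normrN ger0_norm//.
  exact: le_lt_trans kd.
by rewrite normf_div normrX normr_nat.
Qed.

End Arcs.

(** * The closed span of the powers [(z - z0)^(2^k)] *)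

Section LacunaryHull.
Context {R : realType}.
Local Notation C := (R[i]^o).
Implicit Types (Omega K : set C) (z : C).

Definition lacunary_hull Omega z0 : set (holo Omega) :=
  [set psi | forall K, compact_in Omega K -> forall e : C, 0 < e ->
    exists p : {poly C},
      forall z, K z -> `|val psi z - lacunary p (z - z0)| < e].


Arguments lacunary_hull : clear implicits.

Lemma holo_ext Omega (f g : holo Omega) :
  (forall z, Omega z -> val f z = val g z) -> f = g.
Proof.
move=> fg; apply/val_inj/funext => z.
have /asboolP[_ f0] : val f \in holo_pred Omega by exact: valP.
have /asboolP[_ g0] : val g \in holo_pred Omega by exact: valP.
have [/fg//|Oz] := pselect (Omega z); by rewrite f0// g0.
Qed.

Lemma lacunary_hull_subspace Omega z0 : is_subspace (lacunary_hull Omega z0).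
Proof.
split=> [K _ e e0|a f g Wf Wg K OK e e0].
  by exists 0 => z _; rewrite lacunary0 subrr normr0.
have a1 : 0 < `|a| + 1 by rewrite ltr_wpDl.
have [|p fp] := Wf K OK (e / 2 / (`|a| + 1)); first by rewrite !divr_gt0.
have [|q gq] := Wg K OK (e / 2); first by rewrite divr_gt0.
exists (a *: p + q) => z Kz; rewrite lacunary_linear.
have -> : val (a *: f + g) z = a * val f z + val g z by [].
rewrite opprD addrACA -mulrBr (le_lt_trans (ler_normD _ _))//.
rewrite (splitr e) ler_ltD ?gq// normrM.
rewrite (@le_trans _ _ ((`|a| + 1) * (e / 2 / (`|a| + 1))))//.
  by rewrite ler_pM ?lerDl// ltW// fp.
by rewrite mulrC divfK// gt_eqF.
Qed.

Lemma lacunary_hull_closed Omega z0 : closed (lacunary_hull Omega z0).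
Proof.
move=> f Wf K OK e e0; have e20 : 0 < e / 2 by rewrite divr_gt0.
have [g [Wg fg]] := Wf _ ((holo_cvgP f _).1 (@cvg_id _ (nbhs f)) K OK _ e20).
have [p gp] := Wg K OK _ e20.
exists p => z Kz; rewrite -(subrKA (val g z)).
by rewrite (le_lt_trans (ler_normD _ _))// (splitr e) ltrD ?gp// fg.
Qed.

Lemma holo_monomial Omega z0 n : open Omega ->
  exists f : holo Omega, forall z, Omega z -> val f z = (z - z0) ^+ n.
Proof.
move=> oO; pose g : C -> C := fun z => if z \in Omega then (z - z0) ^+ n else 0.
have gO : g \in holo_pred Omega.
  apply/asboolP; split=> [z Oz|z Oz]; last by rewrite /g memNset.
  (* [g] is cut off outside [Omega], but agrees with the power near [z] because [Omega] is open. *)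
  apply: (@near_eq_derivable _ _ _ ((fun z : C => z - z0) ^+ n)).
    near=> w; rewrite /g mem_set ?fctE; last by near: w; exact: open_nbhs_nbhs.
    by elim: (n) => // m IH; rewrite !exprS -IH.
  apply: derivableX; apply: derivableB; first exact: derivable_id.
  exact: derivable_cst.
exists (exist _ g gO) => z Oz /=; by rewrite /g mem_set.
Unshelve. all: by end_near. Qed.

Lemma lacunary_hull_monomial Omega z0 k (f : holo Omega) :
  (forall z, Omega z -> val f z = (z - z0) ^+ (2 ^ k)) ->
  lacunary_hull Omega z0 f.
Proof.
move=> fE K [_ KO] e e0; exists 'X^k => z /KO Oz.
by rewrite lacunaryXn fE// subrr normr0.
Qed.

(** All exponents are positive, so every approximant vanishes at the centre. *)
Lemma lacunary_hull_center Omega z0 (f : holo Omega) :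
  Omega z0 -> lacunary_hull Omega z0 f -> val f z0 = 0.
Proof.
move=> Oz Wf; apply/eqP; rewrite -normr_le0; apply/ler_addgt0Pr => e e0.
have [|p fp] := Wf [set z0] _ e e0.
  by split=> [|_ ->//]; exact: compact_set1.
by have := fp z0 erefl; rewrite subrr lacunary_at0 subr0 add0r => /ltW.
Qed.

(** The case [k0 = 0] of [lacunary_coef_le] at [r], rescaled from [r] to [u]. *)
Lemma circle_coef_le (p : {poly C}) (r d : C) i u : 0 < r ->
  (forall k, `|lacunary p (r * root2 k)| <= d) ->
  `|p`_i * u ^+ (2 ^ i)| <= d * (2 ^+ i * (`|u| / r) ^+ (2 ^ i)).
Proof.
move=> r0 pd; have pr : `|lacunary p r| <= d.
  by have := pd 0; rewrite -[root2 0]expr1 (root2_expn 0) mulr1.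
have := @lacunary_coef_le _ _ norm_root2 root2_le root2S p r d 0 i (leq0n _) pr.
move=> /(_ (fun j _ => pd j.+1)); rewrite big_ord0 addr0 => pi.
have rn : `|r ^+ (2 ^ i)| = r ^+ (2 ^ i) by rewrite normrX gtr0_norm.
rewrite expr_div_n normrM normrX mulrA mulrA ler_pdivlMr ?exprn_gt0//.
by rewrite mulrAC ler_wpM2r ?exprn_ge0// -rn -normrM [leRHS]mulrC.
Qed.

(* No identity theorem is available here: at a point far from the circle, the
   circle only controls the low-order terms of the approximating polynomials, and
   [lacunary_le] controls their tails by means of a compact arc in [Omega]. *)
Lemma lacunary_hull_eq0 Omega z0 (r : C) (f : holo Omega) : open Omega ->
  0 < r -> cis_arc z0 r 0 `<=` Omega -> lacunary_hull Omega z0 f ->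
  (forall k, val f (z0 + r * root2 k) = 0) -> f = 0.
Proof.
move=> oO r0 rO Wf f0; apply: holo_ext => z Oz; apply/eqP.
rewrite -normr_le0; apply/ler_addgt0Pr => e e0; rewrite add0r ltW//.
pose u := z - z0.
have [|s [k vO]] := @open_dilated_arc _ Omega z0 u oO.
  by rewrite /u addrC subrK.
set v := (1 + (2 ^+ s)^-1) * u in vO.
have [B B0 fB] := holo_bounded f (conj (@cis_arc_compact _ z0 v k) vO).
have e20 : 0 < e / 2 by rewrite divr_gt0.
(* By [circle_coef_le], the first [n] terms at [w] sum to at most [bound n w] times the size of the
   polynomial on the circle. *)
pose bound n (w : C) := \sum_(i < n) 2 ^+ i * (`|w| / r) ^+ (2 ^ i).
have bound_ge0 n w : 0 <= bound n w.
  by apply: sumr_ge0 => i _; rewrite mulr_ge0 ?exprn_ge0// divr_ge0// ltW.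
(* The tail length is fixed before [p] is chosen: [B + 1] bounds on the arc any [p] within 1 of [f]
   there. *)
have [n nP] := complex_dyadic_lt (2 ^+ s.+1 * (B + 1 + bound k v)) e20.
pose L := (k + n)%N.
have bP : 2 ^+ s.+1 / 2 ^+ L * (B + 1 + bound k v) < e / 2.
  apply: le_lt_trans nP; rewrite ger0_norm; last first.
    by rewrite mulr_ge0 ?exprn_ge0// addr_ge0// addr_ge0// ltW.
  rewrite mulrAC ler_wpM2l//.
    by rewrite mulr_ge0 ?exprn_ge0// addr_ge0// addr_ge0// ltW.
  by rewrite lef_pV2 ?posrE ?exprn_gt0// ler_weXn2l ?ler1n// leq_addl.
pose c := 1 + bound (s + L)%N u.
have c0 : 0 < c by rewrite ltr_pwDl.
(* Gives both [d <= 1] and [d * c < e / 2], where [c] accounts for the approximation error at [z]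
   and the low-order terms at [u]. *)
pose d := (1 + c / (e / 2))^-1.
have d0 : 0 < d by rewrite invr_gt0 addr_gt0// divr_gt0.
have d1 : d <= 1.
  by rewrite invf_le1 ?lerDl ?divr_ge0// ?ltW// addr_gt0// divr_gt0.
have dc : d * c < e / 2.
  rewrite /d mulrC ltr_pdivrMr ?addr_gt0 ?divr_gt0// mulrDr mulr1.
  by rewrite [e / 2 * _]mulrC divfK ?gt_eqF// ltrDr.
(* The arc serves the tail, the circle the low-order terms, and [z] the comparison with [f]. *)
have [|p fp] := Wf (cis_arc z0 v k `|` cis_arc z0 r 0 `|` [set z]) _ d d0.
  split; last by move=> w [[/vO//|/rO//]|->].
  by apply: compactU; [apply: compactU; exact: cis_arc_compact|exact: compact_set1].
have pr j : `|lacunary p (r * root2 j)| <= d.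
  have := fp (z0 + r * root2 j); rewrite f0 sub0r normrN [z0 + _]addrC addrK.
  by move=> H; apply/ltW/H; left; right; rewrite addrC; exact: cis_arc_root2.
have coef w i : `|p`_i * w ^+ (2 ^ i)| <= d * (2 ^+ i * (`|w| / r) ^+ (2 ^ i)).
  exact: circle_coef_le.
have pv w : cis_arc z0 v k (z0 + w) -> `|lacunary p w| <= B + 1.
  move=> vw; have := fp (z0 + w) (or_introl (or_introl vw)).
  rewrite [z0 + w]addrC addrK addrC distrC => H.
  rewrite -(subrK (val f (z0 + w)) (lacunary p w)) addrC.
  rewrite (le_trans (ler_normD _ _))// lerD ?fB//.
  by rewrite (le_trans _ d1)// ltW.
have sumd n' w : \sum_(i < n') `|p`_i * w ^+ (2 ^ i)| <= d * bound n' w.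
  by rewrite mulr_sumr; apply: ler_sum => i _; exact: coef.
have pu := @lacunary_le _ _ norm_root2 root2_le root2S p u s k L (B + 1)
  (leq_trans (leq_addr n k) (leq_addl s L)) (pv _ (cis_arc_start _ _ _))
  (fun j kj => pv _ (cis_arc_root2 _ _ (leqW kj))).
rewrite -/v in pu.
rewrite -(subrK (lacunary p u) (val f z)) (le_lt_trans (ler_normD _ _))//.
have fz : `|val f z - lacunary p u| <= d by apply/ltW/fp; right.
rewrite (splitr e) (@le_lt_trans _ _ (d * c + 2 ^+ s.+1 / 2 ^+ L *
  (B + 1 + bound k v)))//; last by rewrite ltrD.
rewrite /c mulrDr mulr1 -addrA lerD// (le_trans pu)// lerD//.
rewrite ler_wpM2l ?divr_ge0 ?exprn_ge0// lerD2l (le_trans (sumd _ _))//.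
by rewrite ler_piMl.
Qed.

End LacunaryHull.

Arguments lacunary_hull {R} Omega z0 _.

(** Along an increasing sequence [nu], with terms in [N] from [nu 1] on, [nu j] is coloured by the
    2-adic valuation of [j], which is [k] at every [2^k (2i+1)]. *)
Lemma infinitely_often_partition (N : set nat) :
  (forall i, exists2 n, (i <= n)%N & N n) ->
  exists kappa : nat -> nat, forall k i,
    exists n, [/\ (i <= n)%N, N n & kappa n = k].
Proof.
move=> Ninf; pose next i j := N j /\ (i < j)%N.
have [i|nu [nu0 /all_and2[nuN nuS]]] := @dependent_choice nat next _ 0%N.
  by have [n ni Nn] := cid2 (Ninf i.+1); exists n.
have nu_ge i : (i <= nu i)%N.
  by elim: i => // i IH; exact: leq_ltn_trans (nuS i).
have nu_lt i j : (i < j)%N -> (nu i < nu j)%N.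
  elim: j => // j IH; rewrite ltnS leq_eqVlt => /predU1P[->//|/IH ij].
  exact: ltn_trans (nuS j).
have nu_inj : injective nu.
  by move=> i j ij; case: (ltngtP i j) => // /nu_lt; rewrite ij ltnn.
exists (fun n => logn 2 (xget 0%N [set j | nu j = n])) => k i.
pose j := (2 ^ k * (2 * i).+1)%N.
have j0 : (0 < j)%N by rewrite muln_gt0 expn_gt0.
exists (nu j); split.
- apply: leq_trans (nu_ge j); rewrite /j.
  apply: (@leq_trans (2 * i).+1); first by lia.
  by rewrite leq_pmull// expn_gt0.
- by rewrite -(prednK j0).
- rewrite (@xget_unique _ _ _ j)//; last by move=> l /nu_inj.
  rewrite /j lognM ?expn_gt0// pfactorK// logn_coprime ?addn0//.
  by rewrite coprime2n /= mul2n odd_double.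
Qed.

(** * The subspace of modified multiples of [f], and its closedness *)

Section SequenceSubspace.
Context {R : realType}.
Local Notation C := (R[i]^o).
Variables (Omega : set C) (f : holo_seq Omega).
Variables (z0 : C) (w : nat -> C) (kappa : nat -> nat) (n0 : nat) (z1 : C).
Hypothesis wO : forall k, Omega (w k).
Hypothesis Oz1 : Omega z1.
Implicit Types g h : holo_seq Omega.

Lemma S_ucP g : S_uc Omega g <->
  forall K, compact_in Omega K -> forall e : C, 0 < e ->
    \forall n \near \oo, forall z, K z -> `|val (g n) z| < e.
Proof.
split=> [gu K [cK KO] e e0|gu K cK KO U /uniform_nbhs[E [entE EU]]].
  have := gu K cK KO.
  move=> /(_ [set p : C -> C | forall z, K z -> `|p z| < e]); apply.
  apply/uniform_nbhs; exists [set xy | `|xy.1 - xy.2| < e]; split.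
    by rewrite -entourage_ballE; exists e => //= -[x y].
  by move=> p /= pe z /pe /=; rewrite sub0r normrN.
move: entE; rewrite -entourage_ballE => -[e /= e0 eE].
have := gu K (conj cK KO) e e0; apply: filterS => n ge.
apply: EU => z Kz; apply: eE; rewrite /= -ball_normE /= sub0r normrN.
exact: ge.
Qed.

Lemma holo_eval_continuous z : Omega z ->
  continuous (fun phi : holo Omega => val phi z : C).
Proof.
move=> Oz phi; apply/(@cvgrPdist_lt _ _ _ (nbhs phi) (nbhs_filter phi)) => e e0.
have zO : compact_in Omega [set z].
  by split=> [|_ ->//]; exact: compact_set1.
have := (holo_cvgP phi (nbhs_filter phi)).1 (@cvg_id _ (nbhs phi)) _ zO e e0.
by apply: filterS => psi; exact.
Qed.

Lemma proj_holo_continuous n : continuous (fun g : holo_seq Omega => g n).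
Proof. exact: (@proj_continuous nat (fun=> holo Omega) n). Qed.

Lemma eval_continuous n z : Omega z ->
  continuous (fun g : holo_seq Omega => val (g n) z : C).
Proof.
move=> Oz g.
apply: (@continuous_comp _ _ _ (fun g : holo_seq Omega => g n)
  (fun phi : holo Omega => val phi z : C)).
  exact: proj_holo_continuous.
exact: holo_eval_continuous.
Qed.

(** The constant [c], read off at one point: in the application [kappa n0 = 0] and [w 0 = z0], where
    hull elements vanish, so the multiplier of index [n0] is [c] itself. *)
Definition scalar_part g : C := val (g n0) z1 / val (f n0) z1.

Definition holo_part g : holo Omega := g 0%N - scalar_part g *: f 0%N.

Definition multiplier g n : C :=
  scalar_part g + val (holo_part g) (w (kappa n)).

(* The 0-th term carries an element of the lacunary hull; the other terms are
   the multiples of [f n] prescribed by its values at the points [w k]. *)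
Definition seq_subspace : set (holo_seq Omega) :=
  [set g | lacunary_hull Omega z0 (holo_part g) /\
    forall n z, (0 < n)%N -> Omega z ->
      val (g n) z = multiplier g n * val (f n) z].

Lemma scalar_part_linear a g h :
  scalar_part (a *: g + h) = a * scalar_part g + scalar_part h.
Proof.
rewrite /scalar_part; have -> : val ((a *: g + h) n0) z1 =
  a * val (g n0) z1 + val (h n0) z1 by [].
by rewrite mulrDl mulrA.
Qed.

Lemma holo_part_linear a g h :
  holo_part (a *: g + h) = a *: holo_part g + holo_part h.
Proof.
rewrite /holo_part scalar_part_linear.
have -> : (a *: g + h) 0%N = a *: g 0%N + h 0%N by [].
by rewrite scalerDl scalerBr scalerA opprD addrACA.
Qed.

Lemma multiplier_linear a g h n :
  multiplier (a *: g + h) n = a * multiplier g n + multiplier h n.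
Proof.
rewrite /multiplier scalar_part_linear holo_part_linear.
have -> : val (a *: holo_part g + holo_part h) (w (kappa n)) =
  a * val (holo_part g) (w (kappa n)) + val (holo_part h) (w (kappa n)) by [].
by rewrite addrACA -mulrDr.
Qed.

Lemma scalar_part0 : scalar_part 0 = 0.
Proof. by rewrite /scalar_part (_ : val _ _ = 0)// mul0r. Qed.

Lemma holo_part0 : holo_part 0 = 0.
Proof. by rewrite /holo_part scalar_part0 scale0r subr0. Qed.

Lemma seq_subspace_subspace : is_subspace seq_subspace.
Proof.
have [W0 WD] := lacunary_hull_subspace Omega z0.
split=> [|a g h [Wg gE] [Wh hE]]; split.
- by rewrite holo_part0.
- move=> n z _ _; rewrite /multiplier scalar_part0 holo_part0.
  by rewrite [_ + _]addr0 mul0r.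
- by rewrite holo_part_linear; exact: WD.
- move=> n z n_gt0 Oz; rewrite multiplier_linear mulrDl -mulrA -gE// -hE//.
Qed.

Lemma scalar_part_continuous : continuous scalar_part.
Proof.
move=> g; apply: (@cvgMr_tmp _ _ (nbhs g) (nbhs_filter g)
  (fun h : holo_seq Omega => val (h n0) z1)).
exact: eval_continuous.
Qed.

Lemma holo_part_continuous : continuous holo_part.
Proof.
move=> g.
have -> : holo_part = (fun h => h 0%N + (- scalar_part h) *: f 0%N).
  by apply/funext => h; rewrite /holo_part scaleNr.
apply: (@continuous2_cvg _ _ _ _ _ (nbhs_filter g)
  (fun h : holo_seq Omega => h 0%N) (fun h => - scalar_part h *: f 0%N)
  (fun x y : holo Omega => x + y)).
- exact: (@holo_add_continuous R Omega (_, _)).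
- exact: proj_holo_continuous.
apply: (@continuous2_cvg _ _ _ _ _ (nbhs_filter g)
  (fun h : holo_seq Omega => - scalar_part h) (fun=> f 0%N)
  (fun (a : C) (x : holo Omega) => a *: x)).
- exact: (@holo_scale_continuous R Omega (_, _)).
- by apply: cvgN; exact: scalar_part_continuous.
- exact: cvg_cst.
Qed.

Lemma multiplier_continuous n : continuous (multiplier ^~ n).
Proof.
move=> g; apply: (@cvgD _ C _ (nbhs g) (nbhs_filter g) scalar_part
  (fun h => val (holo_part h) (w (kappa n)))); first exact: scalar_part_continuous.
apply: (@continuous_comp _ _ _ holo_part
  (fun phi : holo Omega => val phi (w (kappa n)) : C)); first exact: holo_part_continuous.
exact: holo_eval_continuous.
Qed.

(** Both conditions depend on [g] through continuous maps, so the set is an intersection of closed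
    preimages. *)
Lemma seq_subspace_closed : closed seq_subspace.
Proof.
have -> : seq_subspace = holo_part @^-1` lacunary_hull Omega z0 `&`
    \bigcap_(x in [set x : nat * C | (0 < x.1)%N /\ Omega x.2])
      (fun g => val (g x.1) x.2 - multiplier g x.1 * val (f x.1) x.2) @^-1`
        [set y | y = 0 :> C].
  apply/seteqP; split=> g [Wg gE]; split=> //.
    by move=> [n z] /= [n0z Oz]; rewrite gE// subrr.
  by move=> n z n_gt0 Oz; apply/eqP; rewrite -subr_eq0; apply/eqP/(gE (n, z)).
apply: closedI.
  apply: preimage_closed; last exact: lacunary_hull_closed.
  by move=> g _; exact: holo_part_continuous.
apply: closed_bigI => -[n z] [/= _ Oz]; apply: preimage_closed; last first.
  by apply: compact_closed; [exact: norm_hausdorff|exact: compact_set1].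
move=> g _; apply: (@cvgB _ C _ (nbhs g) (nbhs_filter g)
  (fun h : holo_seq Omega => val (h n) z)
  (fun h => multiplier h n * val (f n) z)); first exact: eval_continuous.
apply: (@cvgMr_tmp _ _ (nbhs g) (nbhs_filter g) (multiplier ^~ n)).
exact: multiplier_continuous.
Qed.

Hypothesis fz1 : val (f n0) z1 != 0.

Lemma seq_subspace_self : seq_subspace f.
Proof.
have c1 : scalar_part f = 1 by rewrite /scalar_part divff.
have p0 : holo_part f = 0 by rewrite /holo_part c1 scale1r subrr.
split; first by rewrite p0; case: (lacunary_hull_subspace Omega z0).
by move=> n z _ _; rewrite /multiplier c1 p0 [_ + _]addr0 mul1r.
Qed.

End SequenceSubspace.

(** The coordinates in [n] spanning vectors form a matrix with [n+1] rows and [n] columns, whose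
    left kernel is nonzero. *)
Lemma finite_dimensional_dependent (K : numFieldType)
    (X : topologicalLmodType K) (M : set X) : finite_dimensional M ->
  exists n, forall g : nat -> X, (forall k, M (g k)) ->
    exists2 b : 'rV[K]_n.+1, b != 0 & \sum_(k < n.+1) b 0 k *: g k = 0.
Proof.
move=> [n [v [_ vM]]]; exists n => g Mg.
have [c gc] := choice (fun k => vM _ (Mg k)).
pose A : 'M[K]_(n.+1, n) := \matrix_(k, i) c k i.
have /rowV0Pn[b /sub_kermxP bA b0] : kermx A != 0.
  rewrite -mxrank_eq0 mxrank_ker subn_eq0 -ltnNge ltnS.
  by rewrite (leq_trans (rank_leq_col A)).
exists b => //; under eq_bigr do rewrite gc scaler_sumr.
rewrite exchange_big big1//= => i _.
under eq_bigr do rewrite scalerA; rewrite -scaler_suml.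
move/matrixP/(_ 0 i): bA; rewrite !mxE => bA.
rewrite (_ : \sum_(k < n.+1) _ = 0) ?scale0r// -[RHS]bA.
by apply: eq_bigr => k _; rewrite mxE.
Qed.

(** * Infinite dimension, pointwise convergence, and intersection with [S_uc] *)

Section SequenceSubspaceProperties.
Context {R : realType}.
Local Notation C := (R[i]^o).
Variables (Omega : set C) (f : holo_seq Omega) (z0 r z1 : C).
Variables (kappa : nat -> nat) (n0 : nat).
Hypothesis oO : open Omega.
Hypothesis Oz0 : Omega z0.
Hypothesis r0 : 0 < r.
Hypothesis rO : cis_arc z0 r 0 `<=` Omega.

(* The centre forces the scalar part to vanish, the other points the element of
   the lacunary hull. *)
Definition sample k : C := if k is j.+1 then z0 + r * root2 j else z0.

Local Notation w := sample.
Local Notation M := (seq_subspace f z0 w kappa n0 z1).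

(** The k-th lacunary power, put in term 0, extends to an element of [M]. A linear relation among
    these gives a lacunary polynomial vanishing on [Omega], and [circle_coef_le] with bound 0 kills
    its coefficients. *)
Lemma seq_subspace_not_finite_dimensional :
  (0 < n0)%N -> kappa n0 = 0%N -> ~ finite_dimensional M.
Proof.
move=> n0_gt0 kn0 /finite_dimensional_dependent[n dep].
have [e eE] := choice (fun k => @holo_monomial R Omega z0 (2 ^ k) oO).
pose g k : holo_seq Omega :=
  fun n => if n is 0%N then e k else val (e k) (w (kappa n)) *: f n.
have gE k m z : (0 < m)%N ->
    val (g k m) z = val (e k) (w (kappa m)) * val (f m) z by case: m.
have g0 k : scalar_part f n0 z1 (g k) = 0.
  by rewrite /scalar_part gE// kn0 eE// subrr expr0n expn_eq0 /= !mul0r.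
have gp k : holo_part f n0 z1 (g k) = e k.
  by rewrite /holo_part g0 scale0r subr0.
have Mg k : M (g k).
  split; first by rewrite gp; apply: lacunary_hull_monomial (eE k).
  by move=> m z m0 Oz; rewrite /multiplier g0 gp gE// [_ + _]add0r.
have [b /negP b0 gb] := dep g Mg; apply: b0.
have lac0 z : Omega z -> lacunary (rVpoly b) (z - z0) = 0.
  move=> Oz; rewrite (lacunaryE _ (size_poly _ _)).
  transitivity (val ((\sum_(k < n.+1) b 0 k *: g k) 0%N) z); last by rewrite gb.
  rewrite (big_morph (fun h : holo_seq Omega => val (h 0%N) z) (id1 := 0)
    (op1 := +%R))//.
  apply: eq_bigr => k _; rewrite coef_rVpoly_ord -eE//.
apply/eqP/rowP => k; rewrite mxE -coef_rVpoly_ord.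
have circle0 j : `|lacunary (rVpoly b) (r * root2 j)| <= 0.
  rewrite -[r * _](addKr z0) addrC lac0 ?normr0//.
  by apply: rO; exact: cis_arc_root2.
have := circle_coef_le k r r0 circle0.
rewrite mul0r normr_le0 mulf_eq0 => /orP[/eqP//|].
by rewrite expf_eq0 gt_eqF// andbF.
Qed.

(** The sample points lie in a compact subset of [Omega], so the multipliers are bounded. *)
Lemma seq_subspace_S_p : S_p Omega f -> M `<=` S_p Omega.
Proof.
move=> fp h [_ hE] z Oz.
have cK : compact_in Omega (cis_arc z0 r 0 `|` [set z0]).
  split; last by move=> u [/rO//|->].
  by apply: compactU; [exact: cis_arc_compact|exact: compact_set1].
have [B B0 hB] := holo_bounded (holo_part f n0 z1 h) cK.
pose D := `|scalar_part f n0 z1 h| + B.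
have D0 : 0 < D by rewrite ltr_wpDl.
have mD n : `|multiplier f w kappa n0 z1 h n| <= D.
  rewrite (le_trans (ler_normD _ _))// lerD2l hB//.
  by rewrite /sample; case: (kappa n) => [|j]; [right|left; exact: cis_arc_root2].
apply/cvgrPdist_lt => e e0.
have eD : 0 < e / D by rewrite divr_gt0.
have /cvgrPdist_lt/(_ _ eD) fz := fp z Oz.
near=> n; rewrite sub0r normrN hE//; last by near: n; exact: nbhs_infty_gt.
rewrite normrM (@le_lt_trans _ _ (D * `|val (f n) z|))//.
  by rewrite ler_wpM2r.
rewrite mulrC -ltr_pdivlMr// -normrN -sub0r.
by near: n.
Unshelve. all: by end_near. Qed.

(** A nonzero multiplier [m] for some [k] would keep [h n] at size [|m| eps] somewhere on [K0] for
    infinitely many [n]. Once all vanish, the centre gives scalar part 0 and the circle points give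
    [holo_part] 0. *)
Lemma seq_subspace_S_uc (K0 : set C) (eps : C) :
  compact_in Omega K0 -> 0 < eps ->
  (forall k i, exists n, [/\ (i <= n)%N,
    exists2 z, K0 z & eps <= `|val (f n) z| & kappa n = k]) ->
  M `&` S_uc Omega `<=` [set 0].
Proof.
move=> K0O eps0 often h [[Wh hE] /S_ucP huc].
have mult0 k : scalar_part f n0 z1 h + val (holo_part f n0 z1 h) (w k) = 0.
  apply/eqP/negP => /negP m0; set m := (_ + _) in m0.
  have [|n1 _ hn1] := huc K0 K0O (`|m| * eps).
    by rewrite mulr_gt0// normr_gt0.
  (* The successor forces [n > 0], where the product formula for [h n] holds. *)
  have [n [n1n [z Kz fz] kn]] := often k n1.+1.
  have := hn1 n (ltnW n1n) z Kz; rewrite hE ?(leq_ltn_trans _ n1n)//; last first.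
    by case: K0O => _; exact.
  rewrite /multiplier kn -/m normrM ltr_pM2l ?normr_gt0//.
  by move/(le_lt_trans fz); rewrite ltxx.
have s0 : scalar_part f n0 z1 h = 0.
  have pz0 : val (holo_part f n0 z1 h) (w 0%N) = 0.
    exact: lacunary_hull_center Oz0 Wh.
  by have := mult0 0%N; rewrite pz0 [_ + _]addr0.
have p0 : holo_part f n0 z1 h = 0.
  apply: (lacunary_hull_eq0 oO r0 rO Wh) => k.
  by have := mult0 k.+1; rewrite s0 [_ + _]add0r.
apply/funext => -[|n].
  by have := p0; rewrite /holo_part s0 scale0r subr0.
apply: holo_ext => z Oz.
by rewrite hE// /multiplier mult0 mul0r.
Qed.

End SequenceSubspaceProperties.

(** * Witnesses of non-uniform convergence, and the conclusion *)

Lemma not_S_uc (R : realType) (Omega : set (R[i]^o)) (f : holo_seq Omega) :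
  ~ S_uc Omega f -> exists K (eps : R[i]^o),
    [/\ compact_in Omega K, 0 < eps & forall i, exists2 n, (i <= n)%N &
      exists2 z, K z & eps <= `|val (f n) z|].
Proof.
move=> fuc; apply: contrapT => H; apply: fuc; apply/S_ucP => K KO e e0.
apply: contrapT => fe; apply: H; exists K, e; split=> // i.
apply: contrapT => H; apply: fe; exists i => // n /= ni z Kz.
rewrite real_ltNge ?normr_real ?gtr0_real//; apply/negP => efz.
by apply: H; exists n => //; exists z.
Qed.

Theorem theorem3p3 (R : realType) (Omega : set (R[i]^o)) :
  open Omega -> Omega !=set0 ->
  pointwise_spaceable (S_p Omega `\` S_uc Omega).
Proof.
move=> oO [z0 Oz0] f [fp /not_S_uc[K [eps [KO eps0 often]]]].
have [kappa kappaP] := infinitely_often_partition often.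
have [r r0 rO] := open_circle oO Oz0.
(* A positive index of colour 0 and a point with [f n0] nonzero, to normalize [scalar_part]. *)
have [n0 [n0_gt0 [z1 Kz1 fz1] kn0]] := kappaP 0%N 1%N.
have Oz1 : Omega z1 by case: KO => _; exact.
have wO k : Omega (sample z0 r k).
  by case: k => // j; apply: (rO 0%N); exact: cis_arc_root2.
exists (seq_subspace f z0 (sample z0 r) kappa n0 z1); split.
- exact: seq_subspace_subspace.
- exact: seq_subspace_closed.
- exact: seq_subspace_not_finite_dimensional.
- by apply: seq_subspace_self; rewrite -normr_gt0 (lt_le_trans eps0).
- move=> h Mh; have [huc|huc] := pselect (S_uc Omega h).
    right.
    exact: (seq_subspace_S_uc oO Oz0 r0 (rO 0%N) KO eps0 kappaP (conj Mh huc)).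
  by left; split=> //; exact: (seq_subspace_S_p Oz0 (rO 0%N) fp Mh).
Qed.
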